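(* Let $R$ be a PID and let $I:=(a)\subseteq R$ be an ideal of $R$. Consider the unique factorization $a=p_1^{m_1}\cdots p_k^{m_k}$ of $a\in R$ as a product of prime elements. In the quantale of ideals of the ring $R/I$, consider an element $$x:=(l)=(\gcd(l,a))=\left(p_1^{m'_1}\cdots p_k^{m'_k}\right).$$ Then $x$ is a $\mu$-element if and only if there do not exist $i,j,s\in\{1,\ldots,k\}$ such that $i\neq j$, $m'_i<m_i$, $m'_j<m_j$ and $m'_s=m_s$. In particular, $x$ is essential if and only if $m'_i<m_i$ for every $i\in\{1,\ldots,k\}$.
   Context: The factorization presupposes $a\neq 0$; the $p_i$ are pairwise non-associate prime elements and $m_i\geqslant 1$. Every ideal of $R/I$ is generated by the class of some $l\in R$, and equals the ideal generated by the class of $\gcd(l,a)$, which up to a unit is $p_1^{m'_1}\cdots p_k^{m'_k}$ with $0\leqslant m'_i\leqslant m_i$. The ideals of $R/I$ form a quantale under inclusion, with meet given by intersection, join by sum, multiplication by ideal product, bottom $(0)$ and top the whole ring. In such a lattice with bottom $0$, an element $x$ is a $\mu$-element if for every natural number $r\geqslant 2$ and all elements $y_1,\ldots,y_r$ with $\bigwedge_{t=1}^r y_t\neq 0$, the condition $x\wedge y_t\neq 0$ for every $t$ implies $x\wedge\bigl(\bigwedge_{t=1}^r y_t\bigr)\neq 0$. An element $x$ is essential if $x\wedge y\neq 0$ for all $y\neq 0$. *)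

(* Defs.v *)
From HB Require Import structures.
From mathcomp Require Import all_boot all_order all_algebra.
From mathcomp Require Import generic_quotient ring_quotient.
From mathcomp Require Import boolp classical_sets.

Set Implicit Arguments.
Unset Strict Implicit.
Unset Printing Implicit Defensive.

Import Order.TTheory GRing.Theory.

Local Open Scope classical_set_scope.
Local Open Scope ring_scope.
Local Open Scope quotient_scope.

HB.mixin Record isQuantale (d : Order.disp_t) Q of Order.TBLattice d Q := {
  qsup : set Q -> Q;
  qmul : Q -> Q -> Q;
  qsup_ub : forall (S : set Q) (x : Q), S x -> (x <= qsup S)%O;
  qsup_le : forall (S : set Q) (y : Q),
    (forall x, S x -> (x <= y)%O) -> (qsup S <= y)%O;
  qmulA : associative qmul;
  qmul_supr : forall (x : Q) (S : set Q),
    qmul x (qsup S) = qsup [set qmul x y | y in S];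
  qmul_supl : forall (S : set Q) (x : Q),
    qmul (qsup S) x = qsup [set qmul y x | y in S]
}.

#[short(type="quantaleType")]
HB.structure Definition Quantale (d : Order.disp_t) :=
  {Q of isQuantale d Q & Order.TBLattice d Q}.

Definition mu_element (d : Order.disp_t) (Q : quantaleType d) (x : Q) : Prop :=
  forall (r : nat) (y : 'I_r -> Q), (2 <= r)%N ->
    (\meet_(t < r) y t)%O != \bot%O ->
    (forall t, (x `&` y t)%O != \bot%O) ->
    (x `&` \meet_(t < r) y t)%O != \bot%O.

Definition essential (d : Order.disp_t) (Q : quantaleType d) (x : Q) : Prop :=
  forall y : Q, y != \bot%O -> (x `&` y)%O != \bot%O.

(* The ideals of the library, [idealr], are proper and only make sense over
   nontrivial rings; here the whole ring must be an ideal, and R/(a) may be the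
   zero ring. *)
Record ideal (A : comPzRingType) := Ideal {
  idset :> A -> Prop;
  ideal0 : idset 0;
  idealD : forall u v, idset u -> idset v -> idset (u + v);
  idealM : forall c u, idset u -> idset (c * u)
}.

HB.instance Definition _ (A : comPzRingType) := gen_eqMixin (ideal A).
HB.instance Definition _ (A : comPzRingType) := gen_choiceMixin (ideal A).

Section IdealConstructions.
Variable A : comPzRingType.
Implicit Types (I J K : ideal A) (S : set A).

Lemma ideal_ext I J : idset I = idset J -> I = J.
Proof.
case: I J => [I I0 ID IM] [J J0 JD JM] /= eIJ; case: _ / eIJ in J0 JD JM *.
by congr Ideal; exact: Prop_irrelevance.
Qed.

Definition ideal_top : ideal A :=
  @Ideal A setT Logic.I (fun _ _ _ _ => Logic.I) (fun _ _ _ => Logic.I).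

Definition principal_set (b : A) : set A := [set c * b | c in [set: A]].
Lemma principal0 b : principal_set b 0.
Proof. by exists 0 => //; rewrite mul0r. Qed.
Lemma principalD b u v :
  principal_set b u -> principal_set b v -> principal_set b (u + v).
Proof. by move=> [c _ <-] [c' _ <-]; exists (c + c') => //; rewrite mulrDl. Qed.
Lemma principalM b c u : principal_set b u -> principal_set b (c * u).
Proof. by move=> [c' _ <-]; exists (c * c') => //; rewrite mulrA. Qed.
Definition principal b : ideal A :=
  Ideal (principal0 b) (@principalD b) (@principalM b).

Definition meet_set I J : set A := idset I `&` idset J.
Lemma meet0 I J : meet_set I J 0. Proof. by split; exact: ideal0. Qed.
Lemma meetD I J u v : meet_set I J u -> meet_set I J v -> meet_set I J (u + v).
Proof. by move=> [? ?] [? ?]; split; exact: idealD. Qed.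
Lemma meetM I J c u : meet_set I J u -> meet_set I J (c * u).
Proof. by move=> [? ?]; split; exact: idealM. Qed.
Definition ideal_meet I J : ideal A :=
  Ideal (meet0 I J) (@meetD I J) (@meetM I J).

Definition sum_set I J : set A := [set u + v | u in idset I & v in idset J].
Lemma sum0 I J : sum_set I J 0.
Proof.
by exists 0; [exact: ideal0|exists 0; [exact: ideal0|rewrite addr0]].
Qed.
Lemma sumD I J u v : sum_set I J u -> sum_set I J v -> sum_set I J (u + v).
Proof.
move=> [i Ii [j Jj <-]] [i' Ii' [j' Jj' <-]]; exists (i + i'); first exact: idealD.
by exists (j + j'); [exact: idealD|rewrite addrACA].
Qed.
Lemma sumM I J c u : sum_set I J u -> sum_set I J (c * u).
Proof.
move=> [i Ii [j Jj <-]]; exists (c * i); first exact: idealM.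
by exists (c * j); [exact: idealM|rewrite mulrDr].
Qed.
Definition ideal_join I J : ideal A :=
  Ideal (sum0 I J) (@sumD I J) (@sumM I J).

Definition gen_set S : set A :=
  [set u | forall I, S `<=` idset I -> I u].
Lemma gen0 S : gen_set S 0. Proof. by move=> I _; exact: ideal0. Qed.
Lemma genD S u v : gen_set S u -> gen_set S v -> gen_set S (u + v).
Proof. by move=> Su Sv I SI; exact: idealD (Su _ SI) (Sv _ SI). Qed.
Lemma genM S c u : gen_set S u -> gen_set S (c * u).
Proof. by move=> Su I SI; exact: idealM (Su _ SI). Qed.
Definition ideal_gen S : ideal A := Ideal (@gen0 S) (@genD S) (@genM S).

Lemma sub_gen S : S `<=` idset (ideal_gen S).
Proof. by move=> u Su I; apply. Qed.
Lemma gen_sub S I : S `<=` idset I -> idset (ideal_gen S) `<=` idset I.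
Proof. by move=> SI u; apply. Qed.

Definition ideal_mul I J : ideal A :=
  ideal_gen [set u * v | u in idset I & v in idset J].
Definition ideal_sup (C : set (ideal A)) : ideal A :=
  ideal_gen (\bigcup_(I in C) idset I).

Definition ideal_le I J : bool := `[< idset I `<=` idset J >].

Lemma ideal_le_refl : reflexive ideal_le.
Proof. by move=> I; apply/asboolP. Qed.
Lemma ideal_le_anti : antisymmetric ideal_le.
Proof.
move=> I J /andP[/asboolP IJ /asboolP JI]; apply: ideal_ext.
by apply/seteqP.
Qed.
Lemma ideal_le_trans : transitive ideal_le.
Proof.
by move=> J I K /asboolP IJ /asboolP JK; apply/asboolP; exact: subset_trans JK.
Qed.

End IdealConstructions.

Fact ideal_display : Order.disp_t. Proof. exact: Order.Disp tt tt. Qed.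

HB.instance Definition _ (A : comPzRingType) :=
  Order.Le_isPOrder.Build ideal_display (ideal A)
    (@ideal_le_refl A) (@ideal_le_anti A) (@ideal_le_trans A).

Section IdealQuantale.
Variable A : comPzRingType.
Implicit Types (I J K : ideal A) (C : set (ideal A)).

Lemma ideal_leP I J : reflect (idset I `<=` idset J) (I <= J)%O.
Proof. exact: asboolP. Qed.

Lemma ideal_lexI I J K : (I <= ideal_meet J K)%O = (I <= J)%O && (I <= K)%O.
Proof.
apply/ideal_leP/andP => [IJK|[/ideal_leP IJ /ideal_leP IK]].
  by split; apply/ideal_leP => u /IJK [].
by move=> u Iu; split; [exact: IJ|exact: IK].
Qed.

Lemma ideal_leUx I J K : (ideal_join I J <= K)%O = (I <= K)%O && (J <= K)%O.
Proof.
apply/ideal_leP/andP => [IJK|[/ideal_leP IK /ideal_leP JK]].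
  split; apply/ideal_leP => u Iu; apply: IJK.
    by exists u => //; exists 0; [exact: ideal0|rewrite addr0].
  by exists 0; [exact: ideal0|exists u; rewrite ?add0r].
by move=> _ [u Iu [v Jv <-]]; apply: idealD; [exact: IK|exact: JK].
Qed.

Lemma ideal_le0x I : (principal 0 <= I)%O.
Proof.
by apply/ideal_leP => _ [c _ <-]; rewrite mulr0; exact: ideal0.
Qed.

Lemma ideal_lex1 I : (I <= ideal_top A)%O.
Proof. exact/ideal_leP. Qed.

HB.instance Definition _ :=
  Order.POrder_isMeetSemilattice.Build ideal_display (ideal A) ideal_lexI.
HB.instance Definition _ :=
  Order.POrder_isJoinSemilattice.Build ideal_display (ideal A) ideal_leUx.
HB.instance Definition _ :=
  Order.hasBottom.Build ideal_display (ideal A) ideal_le0x.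
HB.instance Definition _ :=
  Order.hasTop.Build ideal_display (ideal A) ideal_lex1.

Lemma ideal_sup_ub C I : C I -> (I <= ideal_sup C)%O.
Proof. by move=> CI; apply/ideal_leP => u Iu; apply: sub_gen; exists I. Qed.

Lemma ideal_sup_le C J :
  (forall I, C I -> (I <= J)%O) -> (ideal_sup C <= J)%O.
Proof.
by move=> CJ; apply/ideal_leP; apply: gen_sub => u [I /CJ /ideal_leP IJ /IJ].
Qed.

Lemma mem_mul I J u v : I u -> J v -> ideal_mul I J (u * v).
Proof. by move=> Iu Jv; apply: sub_gen; exists u => //; exists v. Qed.

Lemma ideal_mul_leP I J K :
  (forall u v, I u -> J v -> K (u * v)) <-> (ideal_mul I J <= K)%O.
Proof.
split=> [IJK|/ideal_leP IJK u v Iu Jv]; last by apply: IJK; exact: mem_mul.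
by apply/ideal_leP; apply: gen_sub => _ [u Iu [v Jv <-]]; exact: IJK.
Qed.

Lemma ideal_mulC : commutative (@ideal_mul A).
Proof.
move=> I J; apply/le_anti/andP; split; apply/ideal_mul_leP => u v Iu Jv;
  by rewrite mulrC; exact: mem_mul.
Qed.

Definition colon_set K J : set A := [set u | forall v, J v -> K (u * v)].
Lemma colon0 K J : colon_set K J 0.
Proof. by move=> v _; rewrite mul0r; exact: ideal0. Qed.
Lemma colonD K J u v :
  colon_set K J u -> colon_set K J v -> colon_set K J (u + v).
Proof.
by move=> Ku Kv w Jw; rewrite mulrDl; apply: idealD; [exact: Ku|exact: Kv].
Qed.
Lemma colonM K J c u : colon_set K J u -> colon_set K J (c * u).
Proof. by move=> Ku v Jv; rewrite -mulrA; apply: idealM; exact: Ku. Qed.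
Definition ideal_colon K J : ideal A :=
  Ideal (@colon0 K J) (@colonD K J) (@colonM K J).

Lemma le_colon I J K : (ideal_mul I J <= K)%O = (I <= ideal_colon K J)%O.
Proof.
apply/idP/ideal_leP => [/ideal_mul_leP IJK u Iu v|IJK]; first exact: IJK.
by apply/ideal_mul_leP => u v /IJK; apply.
Qed.

Lemma ideal_mulA : associative (@ideal_mul A).
Proof.
have mulA_le I J K :
    (ideal_mul (ideal_mul I J) K <= ideal_mul I (ideal_mul J K))%O.
  rewrite le_colon; apply/ideal_mul_leP => u v Iu Jv w Kw.
  by rewrite -mulrA; do 2!apply: mem_mul => //.
move=> I J K; apply/le_anti/andP; split; last exact: mulA_le.
by rewrite (ideal_mulC I) (ideal_mulC J) (ideal_mulC _ K) (ideal_mulC I) mulA_le.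
Qed.

Lemma ideal_mul_supl C I :
  ideal_mul (ideal_sup C) I = ideal_sup [set ideal_mul J I | J in C].
Proof.
apply/le_anti/andP; split.
  rewrite le_colon; apply: ideal_sup_le => J CJ; rewrite -le_colon.
  by apply: ideal_sup_ub; exists J.
apply: ideal_sup_le => _ [J CJ <-]; apply/ideal_mul_leP => u v Ju Iv.
by apply: mem_mul => //; move: u Ju; apply/ideal_leP; exact: ideal_sup_ub.
Qed.

Lemma ideal_mul_supr I C :
  ideal_mul I (ideal_sup C) = ideal_sup [set ideal_mul I J | J in C].
Proof.
rewrite ideal_mulC ideal_mul_supl; congr ideal_sup.
by apply/seteqP; split=> _ [J CJ <-]; exists J => //; exact: ideal_mulC.
Qed.

HB.instance Definition _ :=
  isQuantale.Build ideal_display (ideal A) ideal_sup_ub ideal_sup_le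
    ideal_mulA ideal_mul_supr ideal_mul_supl.

End IdealQuantale.

(* The library only makes {quot J} a ring for proper J; the construction below
   is the same for an arbitrary ideal. *)
Section QuotientRing.
Variables (R : comNzRingType) (J : ideal R).

Definition ideal_pred : R -> bool := fun u => `[< J u >].

Lemma ideal_predP u : reflect (J u) (ideal_pred u).
Proof. exact: asboolP. Qed.

Lemma ideal_pred_zmod_closed : zmod_closed ideal_pred.
Proof.
split=> [|u v /ideal_predP Ju /ideal_predP Jv]; apply/ideal_predP.
  exact: ideal0.
by apply: idealD => //; rewrite -mulN1r; exact: idealM.
Qed.
HB.instance Definition _ := GRing.isZmodClosed.Build R ideal_pred
  ideal_pred_zmod_closed.

Definition quot_ring : Type := Quotient.quot (GRing.ZmodClosed.clone R ideal_pred _).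
HB.instance Definition _ := GRing.Zmodule.on quot_ring.
HB.instance Definition _ := EqQuotient.on quot_ring.

Definition quot_one : quot_ring := \pi_quot_ring 1.
Definition quot_mul (x y : quot_ring) : quot_ring :=
  \pi_quot_ring (repr x * repr y).

Lemma quot_eqP (u v : R) :
  \pi_quot_ring u = \pi_quot_ring v <-> J (u - v).
Proof.
split=> [/eqP|Juv]; first by rewrite -Quotient.idealrBE => /ideal_predP.
by apply/eqP; rewrite -Quotient.idealrBE; apply/ideal_predP.
Qed.

Lemma pi_quot_add (u v : R) :
  \pi_quot_ring (u + v) = \pi_quot_ring u + \pi_quot_ring v.
Proof. exact: Quotient.pi_add. Qed.

Lemma pi_quot_mul (u v : R) :
  \pi_quot_ring (u * v) = quot_mul (\pi_quot_ring u) (\pi_quot_ring v).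
Proof.
have Jrepr w : J (w - repr (\pi_quot_ring w)).
  by apply/quot_eqP; rewrite reprK.
apply/quot_eqP; set u' := repr _; set v' := repr _.
have -> : u * v - u' * v' = v * (u - u') + u' * (v - v').
  by rewrite !mulrBr ![v * _]mulrC addrA subrK.
by apply: idealD; apply: idealM; exact: Jrepr.
Qed.

Lemma quot_mulA : associative quot_mul.
Proof.
elim/quotW=> u; elim/quotW=> v; elim/quotW=> w.
rewrite -(pi_quot_mul v w) -(pi_quot_mul u v).
by rewrite -(pi_quot_mul u) -(pi_quot_mul (u * v)) mulrA.
Qed.
Lemma quot_mulC : commutative quot_mul.
Proof. by move=> x y; rewrite /quot_mul mulrC. Qed.
Lemma quot_mul1 : left_id quot_one quot_mul.
Proof. by elim/quotW=> u; rewrite -pi_quot_mul mul1r. Qed.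
Lemma quot_mulDl : left_distributive quot_mul +%R.
Proof.
elim/quotW=> u; elim/quotW=> v; elim/quotW=> w.
rewrite -pi_quot_add -(pi_quot_mul u w) -(pi_quot_mul v w) -pi_quot_mul.
by rewrite -pi_quot_add mulrDl.
Qed.

HB.instance Definition _ := GRing.Zmodule_isComPzRing.Build quot_ring
  quot_mulA quot_mulC quot_mul1 quot_mulDl.

End QuotientRing.

Lemma pi_quot_is_rmorphism (R : comNzRingType) (J : ideal R) :
  zmod_morphism (\pi_(quot_ring J)) /\ monoid_morphism (\pi_(quot_ring J)).
Proof.
split=> [u v|]; last by split=> // u v; exact: pi_quot_mul.
by apply: (addIr (\pi_(quot_ring J) v)); rewrite -pi_quot_add !subrK.
Qed.

Definition is_PID (R : idomainType) : Prop :=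
  forall J : ideal R, exists b : R, J = principal b.

Definition rdivides (R : comNzRingType) (u v : R) : Prop :=
  exists c : R, v = c * u.

Definition associates (R : comUnitRingType) (u v : R) : Prop :=
  exists2 c : R, c \is a GRing.unit & u = c * v.

Definition prime_elt (R : comUnitRingType) (p : R) : Prop :=
  [/\ p != 0, p \isn't a GRing.unit &
      forall u v, rdivides p (u * v) -> rdivides p u \/ rdivides p v].

Definition is_gcd (R : comNzRingType) (g u v : R) : Prop :=
  [/\ rdivides g u, rdivides g v &
      forall h, rdivides h u -> rdivides h v -> rdivides h g].

(* Main.v *)
Require Import Defs.
From mathcomp Require Import all_boot all_order all_algebra.
From mathcomp Require Import generic_quotient.
From mathcomp Require Import boolp.

Set Implicit Arguments.
Unset Strict Implicit.
Unset Printing Implicit Defensive.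

Import Order.TTheory GRing.Theory.

Local Open Scope ring_scope.
Local Open Scope quotient_scope.

(** Attach to an ideal [K] of [R/(a)] its support: the set of indices [i] such
    that [p_i ^ m_i] does not divide every representative of every element of
    [K]. Then [K] is nonzero iff its support is nonempty, the support of a meet
    is the intersection of the supports (the ideals of [R/(p_i ^ m_i)] form a
    chain), every subset of ['I_k] is the support of some ideal, and the support
    of [x] is [{i | m'_i < m_i}]. So [x] is essential iff its support [S] is
    everything, and it is a mu-element iff a family of sets with a common point,
    each meeting [S], always has a common point in [S]; this fails exactly when
    [S] is proper and has at least two elements. *)

(** * Divisibility by a prime and by its powers in a domain *)

Section Divisibility.
Variable R : idomainType.
Implicit Types (p q u v w : R) (n : nat).

Lemma rdivides_refl u : rdivides u u.
Proof. by exists 1; rewrite mul1r. Qed.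

Lemma rdivides_trans u v w : rdivides u v -> rdivides v w -> rdivides u w.
Proof. by move=> [c ->] [d ->]; exists (d * c); rewrite mulrA. Qed.

Lemma rdivides_mull u v w : rdivides u v -> rdivides u (w * v).
Proof. by move=> [c ->]; exists (w * c); rewrite mulrA. Qed.

Lemma rdivides_add u v w : rdivides u v -> rdivides u w -> rdivides u (v + w).
Proof. by move=> [c ->] [d ->]; exists (c + d); rewrite mulrDl. Qed.

Lemma rdivides_exp2l p n1 n2 : (n1 <= n2)%N -> rdivides (p ^+ n1) (p ^+ n2).
Proof. by move=> le; exists (p ^+ (n2 - n1)); rewrite -exprD subnK. Qed.

Lemma rdivides_prod (I : finType) (F : I -> R) i : rdivides (F i) (\prod_j F j).
Proof. by rewrite (bigD1 i) //= mulrC; exists (\prod_(j | j != i) F j). Qed.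

Lemma rdivides_associates u v w :
  associates u v -> rdivides w u <-> rdivides w v.
Proof.
move=> [c cU ->]; split; last exact: rdivides_mull.
by move/(rdivides_mull c^-1); rewrite mulKr.
Qed.

Lemma associates_rdivides u v w :
  associates u v -> rdivides v w -> rdivides u w.
Proof.
by move=> [c cU ->] [d ->]; exists (d * c^-1); rewrite -mulrA mulKr.
Qed.

Lemma prime_eltNdvd1 p : prime_elt p -> ~ rdivides p 1.
Proof.
move=> [_ pNU _] [c c1]; case/negP: pNU.
by apply/unitrPr; exists c; rewrite mulrC.
Qed.

Lemma prime_elt_dvdX p q n : prime_elt p -> rdivides p (q ^+ n) -> rdivides p q.
Proof.
move=> pP; elim: n => [/(prime_eltNdvd1 pP)//|n IHn].
by rewrite exprS; case: pP => _ _ pM /pM [].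
Qed.

(** As [q] divides [q = c * p], it divides [c] or [p]: the first case makes [p] a unit, the second
    makes [c] one. *)
Lemma prime_elt_dvd_associates p q :
  prime_elt p -> prime_elt q -> rdivides p q -> associates q p.
Proof.
move=> [p0 pNU _] [q0 _ qM] [c qE].
have [//|[d cE]|[d pE]] := qM c p.
- by rewrite -qE; exact: rdivides_refl.
- case/negP: pNU; apply/unitrPr; exists d.
  by apply: (mulIf q0); rewrite mul1r mulrAC mulrC mulrA mulrAC -cE -qE.
- exists c => //; apply/unitrPr; exists d.
  by apply: (mulIf p0); rewrite mul1r mulrAC -qE mulrC -pE.
Qed.

(** Induction on [n]: [p] must divide [u], and cancelling one factor [p] leaves the same problem for
    the quotient. *)
Lemma primeX_dvdM p n u w :
  prime_elt p -> ~ rdivides p w -> rdivides (p ^+ n) (u * w) ->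
  rdivides (p ^+ n) u.
Proof.
move=> pP pNw; elim: n u => [|n IHn] u; first by exists u; rewrite expr0 mulr1.
case: (pP) => p0 _ pM [c uwE].
have [|[d uE]|//] := pM u w.
  by exists (c * p ^+ n); rewrite uwE exprSr mulrA.
have [|e dE] := IHn d.
  by exists c; apply: (mulIf p0); rewrite mulrAC -uE uwE exprSr mulrA.
by exists e; rewrite uE dE exprSr mulrA.
Qed.

(** A bounded form of the valuation: [e] is the exact exponent of [p] in [u], found by induction on
    [n]. *)
Lemma prime_elt_factorX p n u :
  ~ rdivides (p ^+ n) u ->
  exists e w, [/\ (e < n)%N, u = w * p ^+ e & ~ rdivides p w].
Proof.
elim: n => [[]|n IHn pNu]; first by exists u; rewrite expr0 mulr1.
have [[w uE]|/IHn[e [w [en uE pNw]]]] := pselect (rdivides (p ^+ n) u).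
  exists n, w; split=> // -[c wE]; apply: pNu; exists c.
  by rewrite uE wE exprS mulrA.
by exists e, w; split=> //; exact: ltnW.
Qed.

Lemma prime_elt_dvdXX p n1 n2 :
  prime_elt p -> rdivides (p ^+ n1) (p ^+ n2) -> (n1 <= n2)%N.
Proof.
move=> pP [c cE]; rewrite leqNgt; apply/negP => lt; have [p0 _ _] := pP.
apply: (prime_eltNdvd1 pP); exists (c * p ^+ (n1 - n2.+1)).
apply: (mulIf (expf_neq0 n2 p0)).
by rewrite mul1r -!mulrA -exprS -exprD subnK.
Qed.

Lemma prime_elt_dvd_prod p (I : Type) (r : seq I) (P : pred I) (F : I -> R) :
  prime_elt p -> rdivides p (\prod_(i <- r | P i) F i) ->
  exists2 i, P i & rdivides p (F i).
Proof.
move=> pP; elim/big_rec: _ => [/(prime_eltNdvd1 pP)//|i u Pi IHu].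
by case: (pP) => _ _ pM /pM[|/IHu//]; exists i.
Qed.

(** * Products of powers of pairwise non-associate primes *)

Section PairwiseNonassociatePrimes.
Variables (I : finType) (p : I -> R).
Hypothesis p_prime : forall i, prime_elt (p i).
Hypothesis p_nonassoc : forall i j, i != j -> ~ associates (p i) (p j).

Lemma primeX_Ndvd_prod (e : I -> nat) (P : pred I) i :
  ~~ P i -> ~ rdivides (p i) (\prod_(j | P j) p j ^+ e j).
Proof.
move=> NPi /(prime_elt_dvd_prod (p_prime i))[j Pj].
move=> /(prime_elt_dvdX (p_prime i)) ij.
apply: p_nonassoc (prime_elt_dvd_associates (p_prime i) (p_prime j) ij).
by apply: contraNneq NPi => <-.
Qed.

(** Isolating the factor at [i] leaves a cofactor that [p i] does not divide. The condition [0 < n]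
    yields [P i], since [p i ^+ 0] divides everything. *)
Lemma primeX_dvd_prod (e : I -> nat) (P : pred I) n i :
  (0 < n)%N -> rdivides (p i ^+ n) (\prod_(j | P j) p j ^+ e j) ->
  P i /\ (n <= e i)%N.
Proof.
move=> n0 dvd; have [Pi|NPi] := boolP (P i); last first.
  case: (@primeX_Ndvd_prod e P i NPi); apply: rdivides_trans dvd.
  by rewrite -[p i in X in rdivides X]expr1; exact: rdivides_exp2l.
split=> //; apply: (prime_elt_dvdXX (p_prime i)).
rewrite (bigD1 i) //= in dvd; apply: primeX_dvdM dvd; first exact: p_prime.
by apply: primeX_Ndvd_prod; rewrite eqxx andbF.
Qed.

(** Induction on the indices: [p i] does not divide the product already split off, so [p i ^+ e i]
    divides the cofactor [c]. *)
Lemma prod_primeX_dvd (e : I -> nat) u :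
  (forall i, rdivides (p i ^+ e i) u) -> rdivides (\prod_i p i ^+ e i) u.
Proof.
move=> dvd; elim: (index_enum I) (index_enum_uniq I) => [_|i r IHr].
  by exists u; rewrite big_nil mulr1.
move=> /= /andP[iNr r_uniq]; have [c uE] := IHr r_uniq.
have := dvd i; rewrite uE => /primeX_dvdM[||d cE].
- exact: p_prime.
- by rewrite big_uniq //; exact: primeX_Ndvd_prod.
by exists d; rewrite big_cons mulrA -cE.
Qed.

End PairwiseNonassociatePrimes.

End Divisibility.

(** * Supports of ideals of [R/(a)] *)

Section Support.
Variables (R : idomainType) (a : R).
Notation A := (quot_ring (principal a)).
Implicit Types (K L : ideal A) (q u v : R).

(** When [q] divides [a], divisibility by [q] is the same for all representatives of a class. *)
Definition supports q K : bool :=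
  `[< exists2 u, K (\pi_A u) & ~ rdivides q u >].

Lemma supportsP q K :
  reflect (exists2 u, K (\pi_A u) & ~ rdivides q u) (supports q K).
Proof. exact: asboolP. Qed.

Lemma pi_mul u v : \pi_A (u * v) = \pi_A u * \pi_A v.
Proof. exact: pi_quot_mul. Qed.

Lemma principal_piP u v :
  principal (\pi_A u) (\pi_A v) <-> exists c d, v = c * u + d * a.
Proof.
split=> [[c _]|[c [d ->]]].
  elim/quotW: c => c; rewrite -pi_mul => /esym/quot_eqP[d _ dE].
  by exists c, d; rewrite dE addrC subrK.
exists (\pi_A c) => //; rewrite -pi_mul; apply/quot_eqP.
by exists (- d) => //; rewrite opprD addNKr mulNr.
Qed.

Lemma supports_principal q u :
  rdivides q a -> supports q (principal (\pi_A u)) <-> ~ rdivides q u.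
Proof.
move=> qa; split=> [/supportsP[v /principal_piP[c [d ->]] qNv] qu|qNu].
  by apply: qNv; apply: rdivides_add; exact: rdivides_mull.
apply/supportsP; exists u => //; apply/principal_piP.
by exists 1, 0; rewrite mul1r mul0r addr0.
Qed.

Lemma ideal_neq0P K :
  (K != \bot%O) <-> exists2 u, K (\pi_A u) & ~ rdivides a u.
Proof.
have bot_pi u : (\bot%O : ideal A) (\pi_A u) <-> rdivides a u.
  (* The bottom is generated by the zero of the quotient; writing that zero as a class lets
     [principal_piP] apply. *)
  have -> : (\bot%O : ideal A) = principal (\pi_A 0).
    congr principal.
    by apply: (addrI (\pi_A 0)); rewrite -pi_quot_add !addr0.
  split=> [/principal_piP[c [d ->]]|[c ->]].
    by exists d; rewrite mulr0 add0r.
  by apply/principal_piP; exists 0, c; rewrite mulr0 add0r.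
split=> [K0|[u Ku aNu]]; last first.
  by apply/negP => /eqP KE; apply: aNu; apply/bot_pi; rewrite -KE.
apply: contrapT => noK; case/negP: K0; rewrite -lex0.
apply/ideal_leP; elim/quotW => u Ku; apply/bot_pi.
by apply: contrapT => aNu; apply: noK; exists u.
Qed.

Lemma supports_meet (p : R) n K L :
  prime_elt p ->
  supports (p ^+ n) (K `&` L)%O = supports (p ^+ n) K && supports (p ^+ n) L.
Proof.
move=> pP; apply/supportsP/andP => [[u [Ku Lu] pNu]|].
  by split; apply/supportsP; exists u.
move=> [/supportsP[u Ku /prime_elt_factorX[e [u' [en uE pNu]]]]].
move=> /supportsP[v Lv /prime_elt_factorX[f [v' [fn vE pNv]]]].
(* The least common multiple of the p-parts, times both p-free parts. *)
exists (u' * v' * p ^+ maxn e f).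
  have uw : rdivides u (u' * v' * p ^+ maxn e f).
    have [c ->] := rdivides_exp2l p (leq_maxl e f).
    by exists (v' * c); rewrite uE [u' * v']mulrC mulrACA.
  have vw : rdivides v (u' * v' * p ^+ maxn e f).
    have [c ->] := rdivides_exp2l p (leq_maxr e f).
    by exists (u' * c); rewrite vE mulrACA.
  move: uw vw => [c cE] [d dE]; split.
    by rewrite cE pi_mul; exact: idealM.
  by rewrite dE pi_mul; exact: idealM.
(* The factor [u' * v'] cancels, leaving [n <= maxn e f], against [e < n] and [f < n]. *)
rewrite mulrC => dvd.
have pNuv : ~ rdivides p (u' * v') by case: pP => _ _ pM /pM [].
have /(prime_elt_dvdXX pP) := primeX_dvdM pP pNuv dvd.
by rewrite leqNgt gtn_max en fn.
Qed.

(** The case of the empty meet; it fails for [n = 0], as [p ^+ 0] divides everything. *)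
Lemma supports_top (p : R) n :
  prime_elt p -> (0 < n)%N -> supports (p ^+ n) (\top%O : ideal A).
Proof.
move=> pP n0; apply/supportsP; exists 1 => // dvd; apply: (prime_eltNdvd1 pP).
by apply: rdivides_trans dvd; rewrite -{1}[p]expr1; exact: rdivides_exp2l.
Qed.

Lemma supports_bigmeet (p : R) n (I : finType) (y : I -> ideal A) :
  prime_elt p -> (0 < n)%N ->
  supports (p ^+ n) (\meet_i y i)%O = [forall i, supports (p ^+ n) (y i)].
Proof.
move=> pP n0.
rewrite (big_morph _ (fun K L => supports_meet n K L pP) (supports_top pP n0)).
by rewrite big_andE.
Qed.

(** * Supports at the prime powers of the factorization of [a] *)

Section Factorization.
Variables (k : nat) (p : 'I_k -> R) (m : 'I_k -> nat).
Hypothesis p_prime : forall i, prime_elt (p i).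
Hypothesis p_nonassoc : forall i j, i != j -> ~ associates (p i) (p j).
Hypothesis m_gt0 : forall i, (0 < m i)%N.
Hypothesis a_fact : associates a (\prod_(i < k) p i ^+ m i).

Lemma primeX_dvd_factored i : rdivides (p i ^+ m i) a.
Proof.
apply/(rdivides_associates _ a_fact).
exact: (rdivides_prod (fun j => p j ^+ m j)).
Qed.

Lemma ideal_neq0_supports K :
  (K != \bot%O) <-> exists i, supports (p i ^+ m i) K.
Proof.
split=> [/ideal_neq0P[u Ku aNu]|[i /supportsP[u Ku pNu]]]; last first.
  apply/ideal_neq0P; exists u => // au; apply: pNu.
  exact: rdivides_trans (primeX_dvd_factored i) au.
apply: contrapT => noi; apply: aNu; apply: (associates_rdivides a_fact).
apply: prod_primeX_dvd => // i; apply: contrapT => pNu; apply: noi.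
by exists i; apply/supportsP; exists u.
Qed.

Lemma supports_prescribed (T : pred 'I_k) :
  exists K, forall i, supports (p i ^+ m i) K = T i.
Proof.
(* The generator carries the full power of [p j] outside [T], and no factor [p j] inside. *)
exists (principal (\pi_A (\prod_(j | ~~ T j) p j ^+ m j))) => i.
have sP := supports_principal (\prod_(j | ~~ T j) p j ^+ m j)
  (primeX_dvd_factored i).
apply/idP/idP => [/sP pNu|Ti].
  apply: contra_notT pNu => NTi; rewrite (bigD1 i) //= mulrC.
  by exists (\prod_(j | ~~ T j && (j != i)) p j ^+ m j).
apply/sP => /(primeX_dvd_prod p_prime p_nonassoc (m_gt0 i))[].
by rewrite Ti.
Qed.

(** As [p i ^+ m i] divides [a], it divides [l] iff it divides the gcd, that is iff
    [m i <= m' i]. *)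
Lemma supports_principal_gcd l g (m' : 'I_k -> nat) i :
  is_gcd g l a -> associates g (\prod_(i < k) p i ^+ m' i) ->
  supports (p i ^+ m i) (principal (\pi_A l)) = (m' i < m i)%N.
Proof.
move=> [gl _ gmax] g_fact; have pa := primeX_dvd_factored i.
have sP := supports_principal l pa.
apply/idP/idP => [/sP pNl|lt].
  rewrite ltnNge; apply: contra_notN pNl => le; apply: rdivides_trans gl.
  apply/(rdivides_associates _ g_fact); apply: rdivides_trans.
    exact: rdivides_exp2l le.
  exact: (rdivides_prod (fun j => p j ^+ m' j)).
apply/sP => pl; have /(rdivides_associates _ g_fact) := gmax _ pl pa.
move=> /(primeX_dvd_prod p_prime p_nonassoc (m_gt0 i))[_].
by rewrite leqNgt lt.
Qed.

End Factorization.

End Support.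

Theorem theorem5p2 (R : idomainType) (R_PID : is_PID R)
    (a : R) (a_neq0 : a != 0)
    (k : nat) (p : 'I_k -> R) (m : 'I_k -> nat)
    (p_prime : forall i, prime_elt (p i))
    (p_nonassoc : forall i j, i != j -> ~ associates (p i) (p j))
    (m_gt0 : forall i, (1 <= m i)%N)
    (a_fact : associates a (\prod_(i < k) p i ^+ m i))
    (l g : R) (g_gcd : is_gcd g l a)
    (m' : 'I_k -> nat) (m'_le : forall i, (m' i <= m i)%N)
    (g_fact : associates g (\prod_(i < k) p i ^+ m' i))
    (x : ideal (quot_ring (principal a)))
    (x_def : x = principal (\pi_(quot_ring (principal a)) l)) :
  (mu_element x <->
     ~ (exists i j s : 'I_k,
          [/\ i != j, (m' i < m i)%N, (m' j < m j)%N & m' s = m s])) /\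
  (essential x <-> forall i : 'I_k, (m' i < m i)%N).
Proof.
pose supp i (K : ideal (quot_ring (principal a))) := supports (p i ^+ m i) K.
have neq0P K : (K != \bot%O) <-> exists i, supp i K.
  exact: ideal_neq0_supports.
have suppI i K L : supp i (K `&` L)%O = supp i K && supp i L.
  exact: supports_meet.
have supp_bigI i r (y : 'I_r -> _) :
    supp i (\meet_(t < r) y t)%O = [forall t, supp i (y t)].
  by apply: supports_bigmeet; [exact: p_prime|exact: m_gt0].
have supp_ex (T : pred 'I_k) : exists K, forall i, supp i K = T i.
  exact: supports_prescribed.
have suppx i : supp i x = (m' i < m i)%N.
  by rewrite x_def; apply: supports_principal_gcd g_gcd g_fact.
split; split.
- move=> mux [i [j [s [ij lti ltj m's]]]].
  (* The supports [{i, s}] and the complement of [i] share only [s], which [x] misses, while [x]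
     meets the first at [i] and the second at [j]. *)
  have [y1 y1P] := supp_ex (pred2 i s).
  have [y2 y2P] := supp_ex (predC1 i).
  have is_neq : s != i by apply: contraTneq lti => <-; rewrite m's ltnn.
  pose y (t : 'I_2) := if t == ord0 then y1 else y2.
  have /neq0P[n] : (x `&` \meet_(t < 2) y t)%O != \bot%O.
    apply: mux => // [|t].
      apply/neq0P; exists s; rewrite supp_bigI; apply/forallP => t.
      by rewrite /y; case: ifP => _; rewrite ?y1P ?y2P /= ?eqxx ?orbT.
    apply/neq0P; rewrite /y; case: ifP => _.
      by exists i; rewrite suppI suppx lti y1P /= eqxx.
    by exists j; rewrite suppI suppx ltj y2P /= eq_sym.
  rewrite suppI suppx supp_bigI => /andP[ltn /forallP yn].
  have := yn ord0; have := yn ord_max; rewrite /y /= y1P y2P /=.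
  by move=> /negPf -> /= /eqP ns; rewrite ns m's ltnn in ltn.
- move=> noijs r y r2 /neq0P[s]; rewrite supp_bigI => /forallP ys xy.
  apply/neq0P.
  have [lts|ges] := boolP (m' s < m s)%N.
    by exists s; rewrite suppI suppx lts supp_bigI; apply/forallP.
  (* With [s] outside the support of [x], [noijs] leaves that support at most one index, which every
     [y t] must then contain in its support. *)
  have m's : m' s = m s by apply/eqP; rewrite eqn_leq m'_le leqNgt.
  (* The index [0] of the family, available because [r] is positive, shows that the support of [x]
     is nonempty. *)
  have /neq0P[i] := xy (Ordinal (ltnW r2)).
  rewrite suppI suppx => /andP[lti _].
  exists i; rewrite suppI suppx lti supp_bigI; apply/forallP => t.
  have /neq0P[j] := xy t; rewrite suppI suppx => /andP[ltj yj].
  have [-> //|ij] := eqVneq i j.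
  by case: noijs; exists i, j, s.
(* Testing essentiality on an ideal with support [{i}] forces [i] into the support of [x]. *)
- move=> ess i; have [y yP] := supp_ex (pred1 i).
  have /neq0P[j] : (x `&` y)%O != \bot%O.
    by apply: ess; apply/neq0P; exists i; rewrite yP /=.
  by rewrite suppI suppx yP => /andP[lt /eqP <-].
- move=> lt y /neq0P[i yi]; apply/neq0P; exists i.
  by rewrite suppI suppx lt yi.
Qed.
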